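(* Let $X\subset\mathbb{R}^n$ be a convex closed semialgebraic set and let $r>0$. If $f\in\mathbb{R}[x]$, $x=(x_1,\dots,x_n)$, is a polynomial such that $f(x)>0$ for $x\in X$, then there exists $N_0\in\mathbb{N}$ such that for any integer $N\ge N_0$ and any $\xi\in\mathbb{R}^n$ with $|\xi|\le r$, the function $\varPhi_{N,\xi}(x)=e^{e^{N|x-\xi|^2}}f(x)$ is strongly convex on $X$. Moreover, there exists $\alpha\in\mathbb{R}$ such that the function $\varPhi_\xi(x)=e^{e^{|x-\xi|^2}}[f(x)+\alpha]$, $x\in\mathbb{R}^n$, is strongly convex on $X$ for every $\xi\in\mathbb{R}^n$ with $|\xi|\le r$.
   Context: $|\cdot|$ is the Euclidean norm on $\mathbb{R}^n$. A function $\varphi$ is strongly convex on a convex set $X$ if for some $\mu>0$ the function $\varphi(x)-\frac{\mu}{2}|x|^2$ is convex on $X$. *)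

(* Defs.v *)
From mathcomp Require Import all_boot all_order all_algebra.
From mathcomp Require Import classical_sets reals topology normedtype sequences convex.
(* Not imported: its notations clash with those of MathComp-Analysis. *)
From mathcomp Require mpoly.

Set Implicit Arguments.
Unset Strict Implicit.
Unset Printing Implicit Defensive.

Import Order.TTheory GRing.Theory Num.Theory numFieldNormedType.Exports.

Local Open Scope classical_set_scope.
Local Open Scope ring_scope.

(* The norm `|x| of the library on 'rV[R]_n is the maximum norm; it induces the
   same topology on 'rV[R]_n as the Euclidean one. *)
Definition enorm (R : realType) (n : nat) (x : 'rV[R]_n) : R :=
  Num.sqrt (\sum_(i < n) x 0 i ^+ 2).

Definition peval (R : realType) (n : nat) (p : mpoly.mpoly n R)
    (x : 'rV[R]_n) : R :=
  mpoly.meval (fun i => x 0 i) p.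

(* Finite union of sets, each defined by finitely many polynomial equations
   p = 0 (p in pq.1) and strict inequalities q > 0 (q in pq.2). *)
Definition semialgebraic (R : realType) (n : nat) (X : set 'rV[R]_n) : Prop :=
  exists S : seq (seq (mpoly.mpoly n R) * seq (mpoly.mpoly n R)),
    X = [set x : 'rV[R]_n |
          has (fun pq => all (fun p => peval p x == 0) pq.1 &&
                         all (fun q => 0 < peval q x) pq.2) S].

Definition strongly_convex (R : realType) (n : nat) (X : set 'rV[R]_n)
    (phi : 'rV[R]_n -> R) : Prop :=
  exists mu : R, 0 < mu /\
    convex_function X (fun x => phi x - mu / 2 * enorm x ^+ 2).

(* Main.v *)
Require Import Defs.
From mathcomp Require Import all_boot all_order all_algebra.
From mathcomp Require Import classical_sets reals topology normedtype sequences convex.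
From mathcomp Require Import boolp functions derive realfun exp interval_inference lra ring.
From mathcomp Require mpoly ordered_qelim qe_rcf.

(** Restrict Phi = exp (exp (a |x - xi|^2)) F to a line with direction v and
    write g = exp (a |x - xi|^2), F', F'' for the derivatives of F along the
    line and G = g' for that of g.  Then
      Phi'' = exp g ((g'' + G^2) F + 2 G F' + F''),
    where g'' >= 2 a |v|^2 g.  Completing the square in G, the terms
    G^2 F + 2 G F' are at least - F'^2 / F, so that, if d bounds |F'| / |v| and
    |F''| / |v|^2, the function Phi is strongly convex on X with constant 1 as
    soon as F > 0 and
      d^2 / F + d + 1 <= 2 a exp (a |x - xi|^2) F   on X
    ([strongly_convex_expexp]).

    For a polynomial, d grows at most like a power of |x|
    ([poly_growth_polynomials]), and such a power is dominated by
    exp (|x - xi|^2), uniformly for |xi| <= r ([weight_le_expR]).  With a = 1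
    and F = f + alpha, a large alpha therefore makes the right-hand side win:
    this is the second assertion.  With a = N and F = f the same argument
    works as soon as f does not tend to 0 on X faster than a negative power of
    |x|.  This follows from the semialgebraicity of X
    ([lojasiewicz_at_infinity]): by quantifier elimination, the condition
      forall x in X, |x|^2 <= t -> 1 <= y f x
    on (t, y) is a boolean combination of sign conditions on polynomials in t
    and y, and each of those has a constant sign in a region
    t >= K, y >= t^K.  The condition holds for some point of the
    region, because X is closed and f has a positive minimum on its compact
    pieces; hence it holds at (t, t^K) for all large t. *)

Set Implicit Arguments.
Unset Strict Implicit.
Unset Printing Implicit Defensive.

Import Order.TTheory GRing.Theory Num.Theory numFieldNormedType.Exports.

Local Open Scope classical_set_scope.
Local Open Scope ring_scope.

(** * Sign conditions in the region t >= K, y >= t^K *)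

(** The regions t >= K, y >= t^K decrease with K once t >= 1, so that the
    properties below form a filter, in which y dominates every power of t. *)
Definition at_far (R : realType) (P : R -> R -> Prop) : Prop :=
  exists K : nat, forall t y : R, K%:R <= t -> t ^+ K <= y -> P t y.

Lemma at_farS (R : realType) (P Q : R -> R -> Prop) :
  (forall t y, P t y -> Q t y) -> at_far P -> at_far Q.
Proof. by move=> PQ [K hK]; exists K => t y tK yK; apply/PQ/hK. Qed.

Lemma at_farI (R : realType) (P Q : R -> R -> Prop) :
  at_far P -> at_far Q -> at_far (fun t y => P t y /\ Q t y).
Proof.
move=> [K hK] [L hL]; exists (maxn K L).+1 => t y t_ge y_ge.
have t1 : 1 <= t by apply: le_trans t_ge; rewrite ler1n.
have small M : (M <= maxn K L)%N -> M%:R <= t /\ t ^+ M <= y.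
  move=> /leqW leM; split; first by apply: le_trans t_ge; rewrite ler_nat.
  by apply: le_trans y_ge; rewrite ler_weXn2l.
have [tK yK] := small K (leq_maxl _ _); have [tL yL] := small L (leq_maxr _ _).
by split; [exact: hK | exact: hL].
Qed.

Lemma at_far_ge (R : realType) (c : R) : at_far (fun t _ => c <= t).
Proof.
exists (Num.bound `|c|) => t _ t_ge _; apply: le_trans t_ge.
by rewrite (le_trans (ler_norm c))// ltW// archi_boundP.
Qed.

Lemma at_far_expr (R : realType) (m : nat) :
  at_far (fun t y : R => 1 <= t /\ t ^+ m <= y).
Proof.
exists m.+1 => t y t_ge y_ge.
have t1 : 1 <= t by apply: le_trans t_ge; rewrite ler1n.
by split=> //; apply: le_trans y_ge; rewrite ler_weXn2l.
Qed.

Lemma at_far_poly_le (R : realType) (p : {poly R}) :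
  exists m, at_far (fun t _ => `|p.[t]| <= t ^+ m).
Proof.
elim/poly_ind: p => [|p c [m IH]].
  by exists 0%N, 0%N => t y _ _; rewrite horner0 normr0 expr0.
(* The second extra power of t absorbs the factor 1 + |c|. *)
exists m.+2.
have /(at_farI IH) := at_farI (at_far_expr R 0) (at_far_ge (1 + `|c|)).
apply: at_farS => t y [pt [[t1 _] tc]]; rewrite !hornerE.
have tm : 1 <= t ^+ m.+1 by rewrite exprn_ege1.
have t0 : 0 <= t by lra.
apply: (le_trans (ler_normD _ _)); rewrite normrM (ger0_norm t0).
have : `|p.[t]| * t <= t ^+ m.+1 by rewrite exprSr ler_wpM2r.
have : `|c| <= `|c| * t ^+ m.+1 by rewrite ler_peMr.
have : (1 + `|c|) * t ^+ m.+1 <= t ^+ m.+2.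
  by rewrite [leRHS]exprS ler_wpM2r// (le_trans ler01).
lra.
Qed.

(** Only the sign of s matters; rescaling it turns any positive lower bound
    into 1, which leaves no constant to track in the induction. *)
Lemma at_far_poly_sign (R : realType) (p : {poly R}) : p != 0 ->
  exists s, at_far (fun t _ => 1 <= s * p.[t]).
Proof.
elim/poly_ind: p => [|p c IH]; first by rewrite eqxx.
have [->|p0] := eqVneq p 0.
  rewrite mul0r add0r polyC_eq0 => c0.
  by exists c^-1, 0%N => t y _ _; rewrite hornerC mulVf.
have [s IHs] := IH p0; move=> _; exists s.
have /(at_farI IHs) := at_farI (at_far_ge 1) (at_far_ge (1 - s * c)).
apply: at_farS => t _ [pt [t1 tc]]; rewrite !hornerE mulrDr mulrA.
have : t <= s * p.[t] * t by rewrite ler_peMl// (le_trans ler01).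
lra.
Qed.

(** Horner's scheme in y: if s P >= 1 for the quotient P, then s (P y + a) is at
    least y - |s| |a(t)|, and y exceeds any power of t. *)
Lemma at_far_bipoly_sign (R : realType) (P : {poly {poly R}}) : P != 0 ->
  exists s, at_far (fun t y => 1 <= s * P.[y%:P].[t]).
Proof.
elim/poly_ind: P => [|P a IH]; first by rewrite eqxx.
have [->|P0] := eqVneq P 0.
  rewrite mul0r add0r polyC_eq0 => /at_far_poly_sign[s hs].
  by exists s; apply: at_farS hs => t y; rewrite hornerC.
have [s IHs] := IH P0; move=> _; exists s.
have [m am] := at_far_poly_le a.
have /(at_farI am)/(at_farI IHs) :=
  at_farI (at_far_expr R m.+1) (at_far_ge (1 + `|s|)).
apply: at_farS => t y [Pt [at_ [[t1 ty] ts]]]; rewrite !hornerE mulrDr mulrA.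
have tm : 1 <= t ^+ m by rewrite exprn_ege1.
have y0 : 0 <= y by apply: le_trans ty; rewrite exprn_ge0// (le_trans ler01).
have : y <= s * P.[y%:P].[t] * y by rewrite ler_peMl.
have : - (s * a.[t]) <= `|s| * t ^+ m.
  by rewrite (le_trans (ler_norm _))// normrN normrM ler_wpM2l.
have : (1 + `|s|) * t ^+ m <= t ^+ m.+1.
  by rewrite exprS ler_wpM2r// (le_trans ler01).
lra.
Qed.

Lemma term_bipoly (R : realType) (u : GRing.term R) : GRing.rterm u ->
  exists P : {poly {poly R}},
    forall t y, GRing.eval [:: t; y] u = P.[y%:P].[t].
Proof.
elim: u => //=.
- move=> [|[|i]] _; [exists ('X)%:P | exists 'X | exists 0] => t y;
    by rewrite /= ?hornerE ?nth_nil.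
- by move=> c _; exists c%:P%:P => t y; rewrite !hornerC.
- by move=> k _; exists k%:R => t y; rewrite -polyC_natr hornerC -polyC_natr hornerC.
- move=> u IHu v IHv /andP[/IHu[P hP] /IHv[Q hQ]].
  by exists (P + Q) => t y; rewrite !hornerE hP hQ.
- by move=> u IHu /IHu[P hP]; exists (- P) => t y; rewrite !hornerE hP.
- by move=> u IHu k /IHu[P hP]; exists (P *+ k) => t y; rewrite !hornerMn hP.
- move=> u IHu v IHv /andP[/IHu[P hP] /IHv[Q hQ]].
  by exists (P * Q) => t y; rewrite !hornerE hP hQ.
- by move=> u IHu k /IHu[P hP]; exists (P ^+ k) => t y; rewrite !horner_exp hP.
Qed.

Lemma at_far_term_sg (R : realType) (u v : GRing.term R) :
  GRing.rterm u -> GRing.rterm v -> exists s : R, at_far (fun t y =>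
    Num.sg (GRing.eval [:: t; y] u - GRing.eval [:: t; y] v) = s).
Proof.
move=> /term_bipoly[P hP] /term_bipoly[Q hQ].
have E t y : GRing.eval [:: t; y] u - GRing.eval [:: t; y] v =
    (P - Q).[y%:P].[t] by rewrite hP hQ !hornerE.
have [PQ|/at_far_bipoly_sign[s hs]] := eqVneq (P - Q) 0.
  by exists 0, 0%N => t y _ _; rewrite E PQ !horner0 sgr0.
exists (Num.sg s); apply: at_farS hs => t y; rewrite E.
move: (_.[t]) => d sd.
have : Num.sg (s * d) = 1 by apply: gtr0_sg; lra.
rewrite sgrM; case: (sgrP s) => _; case: (sgrP d) => _; lra.
Qed.

(** The truth value of an atom only depends on the sign of a polynomial in
    (t, y), where t and y are the variables of index 0 and 1. *)
Lemma qf_at_far_const (R : realType) (phi : ordered_qelim.ord.formula R) :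
  ordered_qelim.ord.qf_form phi -> ordered_qelim.ord.rformula phi ->
  exists b : bool, at_far (fun t y =>
    ordered_qelim.ord.qf_eval [:: t; y] phi = b).
Proof.
elim: phi => //=.
- by move=> b _ _; exists b, 0%N.
- move=> u v _ /andP[ru rv]; have [s hs] := at_far_term_sg ru rv.
  exists (s == 0); apply: at_farS hs => t y <-.
  by rewrite sgr_eq0 subr_eq0.
- move=> u v _ /andP[ru rv]; have [s hs] := at_far_term_sg ru rv.
  exists (s < 0); apply: at_farS hs => t y <-.
  by rewrite sgr_lt0 subr_lt0.
- move=> u v _ /andP[ru rv]; have [s hs] := at_far_term_sg ru rv.
  exists (s <= 0); apply: at_farS hs => t y <-.
  by rewrite sgr_le0 subr_le0.
- move=> f IHf g IHg /andP[qf qg] /andP[rf rg].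
  have [[b hb] [c hc]] := (IHf qf rf, IHg qg rg).
  by exists (b && c); apply: at_farS (at_farI hb hc) => t y [-> ->].
- move=> f IHf g IHg /andP[qf qg] /andP[rf rg].
  have [[b hb] [c hc]] := (IHf qf rf, IHg qg rg).
  by exists (b || c); apply: at_farS (at_farI hb hc) => t y [-> ->].
- move=> f IHf g IHg /andP[qf qg] /andP[rf rg].
  have [[b hb] [c hc]] := (IHf qf rf, IHg qg rg).
  by exists (b ==> c); apply: at_farS (at_farI hb hc) => t y [-> ->].
- move=> f IHf qf rf; have [b hb] := IHf qf rf.
  by exists (~~ b); apply: at_farS hb => t y ->.
Qed.

(** Quantifier elimination over the real closed field R reduces the general case
    to that of quantifier-free formulas. *)
Lemma formula_at_far_const (R : realType) (phi : ordered_qelim.ord.formula R) :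
  exists b : bool, at_far (fun t y =>
    ordered_qelim.ord.holds [:: t; y] phi <-> b).
Proof.
pose w n (s : seq (GRing.term R) * seq (GRing.term R)) :=
  qe_rcf.qfr_to_formula (qe_rcf.wproj n s).
pose psi := ordered_qelim.ord.quantifier_elim w (ordered_qelim.ord.to_rform phi).
have /andP[qpsi rpsi] : ordered_qelim.ord.qf_form psi &&
    ordered_qelim.ord.rformula psi.
  apply: ordered_qelim.ord.quantifier_elim_wf.
    exact: (@qe_rcf.wf_QE_wproj R).
  exact: ordered_qelim.ord.to_rform_rformula.
have [b hb] := qf_at_far_const qpsi rpsi.
exists b; apply: at_farS hb => t y hb.
have := qe_rcf.rcf_satP [:: t; y] phi.
rewrite /qe_rcf.rcf_sat /ordered_qelim.ord.proj_sat -/psi hb => hP.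
by split => /hP.
Qed.

(** * Functions obtained from the coordinates by ring operations *)

Lemma enorm_sqr (R : realType) (n : nat) (x : 'rV[R]_n) :
  enorm x ^+ 2 = \sum_(i < n) x 0 i ^+ 2.
Proof. by rewrite sqr_sqrtr// sumr_ge0// => i _; rewrite sqr_ge0. Qed.

Lemma enorm_ge0 (R : realType) (n : nat) (x : 'rV[R]_n) : 0 <= enorm x.
Proof. exact: sqrtr_ge0. Qed.

Lemma coord_le_enorm (R : realType) (n : nat) (x : 'rV[R]_n) i :
  `|x 0 i| <= enorm x.
Proof.
rewrite -[leLHS]sqrtr_sqr ler_sqrt; last by rewrite sumr_ge0// => j _; rewrite sqr_ge0.
by rewrite (bigD1 i)//= lerDl sumr_ge0// => j _; rewrite sqr_ge0.
Qed.

(** Closure conditions that let a property reach all polynomial functions.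
    Definability, continuity and polynomial growth are proved through them. *)
Definition contains_polynomials (R : realType) (n : nat)
    (P : ('rV[R]_n -> R) -> Prop) : Prop :=
  [/\ forall c, P (fun=> c), forall i, P (fun x => x 0 i),
      forall F G, P F -> P G -> P (fun x => F x + G x) &
      forall F G, P F -> P G -> P (fun x => F x * G x)].

Section ContainsPolynomials.
Variables (R : realType) (n : nat) (P : ('rV[R]_n -> R) -> Prop).
Hypothesis Ppoly : contains_polynomials P.

Lemma contains_exp F k : P F -> P (fun x => F x ^+ k).
Proof.
case: Ppoly => Pc _ _ PM PF; elim: k => [|k IH]; first exact: Pc.
by under eq_fun do rewrite exprS; exact: PM.
Qed.

Lemma contains_prod (I : Type) (s : seq I) F :
  (forall i, P (F i)) -> P (fun x => \prod_(i <- s) F i x).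
Proof.
case: Ppoly => Pc _ _ PM PF; elim: s => [|i s IH].
  by under eq_fun do rewrite big_nil; exact: Pc.
by under eq_fun do rewrite big_cons; exact: PM.
Qed.

Lemma contains_sum (I : Type) (s : seq I) F :
  (forall i, P (F i)) -> P (fun x => \sum_(i <- s) F i x).
Proof.
case: Ppoly => Pc _ PD _ PF; elim: s => [|i s IH].
  by under eq_fun do rewrite big_nil; exact: Pc.
by under eq_fun do rewrite big_cons; exact: PD.
Qed.

Lemma contains_peval (f : mpoly.mpoly n R) : P (peval f).
Proof.
have -> : peval f = fun x => \sum_(m <- mpoly.msupp f)
    mpoly.mcoeff m f * \prod_(i <- index_enum 'I_n)
      (x 0 i) ^+ mpoly.fun_of_multinom m i.
  by apply/funext => x; exact: mpoly.mevalE.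
case: Ppoly => Pc Px _ PM; apply: contains_sum => m; apply: PM => //.
by apply: contains_prod => i; exact: contains_exp.
Qed.

Lemma contains_enorm_sqr : P (fun x => enorm x ^+ 2).
Proof.
have -> : (fun x : 'rV[R]_n => enorm x ^+ 2) =
    fun x => \sum_(i <- index_enum 'I_n) x 0 i ^+ 2.
  by apply/funext => x; exact: enorm_sqr.
by case: Ppoly => _ Px _ _; apply: contains_sum => i; exact: contains_exp.
Qed.

End ContainsPolynomials.

(** * First-order definability *)

Definition rowseq (R : realType) (n : nat) (x : 'rV[R]_n) : seq R :=
  [seq x 0 i | i <- enum 'I_n].

Lemma nth_rowseq (R : realType) (n : nat) (x : 'rV[R]_n) (i : 'I_n) :
  (rowseq x)`_i = x 0 i.
Proof. by rewrite (nth_map i) ?size_enum_ord// nth_ord_enum. Qed.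

(** In the two definitions below, the variables 0 and 1 stand for t and y and
    the variable i + 2 for the coordinate i of x. *)
Definition term_fun (R : realType) (n : nat) (F : R -> R -> 'rV[R]_n -> R) :=
  exists u : GRing.term R, forall t y x,
    GRing.eval [:: t, y & rowseq x] u = F t y x.

Definition definable (R : realType) (n : nat)
    (P : R -> R -> 'rV[R]_n -> Prop) :=
  exists phi : ordered_qelim.ord.formula R, forall t y x,
    ordered_qelim.ord.holds [:: t, y & rowseq x] phi <-> P t y x.

Lemma term_fun_polynomials (R : realType) (n : nat) :
  contains_polynomials (fun F : 'rV[R]_n -> R => term_fun (fun _ _ => F)).
Proof.
split.
- by move=> c; exists (GRing.Const c).
- move=> i; exists (GRing.Var _ i.+2) => t y x.
  by rewrite -nth_rowseq.
- by move=> F G [u hu] [v hv]; exists (GRing.Add u v) => t y x /=; rewrite hu hv.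
- by move=> F G [u hu] [v hv]; exists (GRing.Mul u v) => t y x /=; rewrite hu hv.
Qed.

Lemma definable_semialgebraic (R : realType) (n : nat) (X : set 'rV[R]_n) :
  semialgebraic X -> definable (fun _ _ => X).
Proof.
move=> [S ->].
have def_all (Q : mpoly.mpoly n R -> 'rV[R]_n -> bool) s :
    (forall p, definable (fun _ _ => Q p)) ->
    definable (fun _ _ x => all (Q^~ x) s).
  move=> defQ; elim: s => [|p s [phi hphi]].
    by exists (ordered_qelim.ord.Bool true).
  have [psi hpsi] := defQ p.
  exists (ordered_qelim.ord.And psi phi) => t y x /=.
  by rewrite hphi hpsi; split => [[-> ->]//|/andP].
elim: S => [|[ps qs] S [phi hphi]].
  by exists (ordered_qelim.ord.Bool false).
have [] := def_all (fun p x => peval p x == 0) ps.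
  move=> p; have [u hu] := contains_peval (@term_fun_polynomials R n) p.
  exists (ordered_qelim.ord.Equal u (GRing.Const 0)) => t y x /=.
  by rewrite hu; split=> /eqP.
move=> e he; have [] := def_all (fun q x => 0 < peval q x) qs.
  move=> q; have [u hu] := contains_peval (@term_fun_polynomials R n) q.
  by exists (ordered_qelim.ord.Lt (GRing.Const 0) u) => t y x /=; rewrite hu.
move=> l hl.
exists (ordered_qelim.ord.Or (ordered_qelim.ord.And e l) phi) => t y x /=.
rewrite he hl hphi /=; split.
  by case=> [[-> ->]//|->]; rewrite orbT.
by case/orP => [/andP|]; [left|right].
Qed.

(** Closing a formula in t, y and x over the n coordinates of x, one variable at
    a time, amounts to one quantification over vectors. *)
Lemma definable_forall (R : realType) (n : nat)
    (P : R -> R -> 'rV[R]_n -> Prop) : definable P ->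
  exists psi : ordered_qelim.ord.formula R, forall t y,
    ordered_qelim.ord.holds [:: t; y] psi <-> forall x, P t y x.
Proof.
move=> [phi hphi].
have close m e k : size e = k ->
    ordered_qelim.ord.holds e
      (foldr (@ordered_qelim.ord.Forall _) phi (iota k m)) <->
    forall s, size s = m -> ordered_qelim.ord.holds (e ++ s) phi.
  elim: m e k => [|m IH] e k ek /=.
    split=> [h s /size0nil ->|/(_ [::] erefl)]; by rewrite cats0.
  have step z : set_nth 0 e k z = rcons e z by rewrite -ek set_nthE ltnn subnn cats1.
  split=> [h [|z s] //= [sm]|h z].
    have := h z; rewrite step IH ?size_rcons ?ek// => /(_ s sm).
    by rewrite cat_rcons.
  rewrite step IH ?size_rcons ?ek// => s sm.
  by rewrite cat_rcons; apply: h => /=; rewrite sm.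
exists (foldr (@ordered_qelim.ord.Forall _) phi (iota 2 n)) => t y.
rewrite close//; split=> [h x|h s sn].
  by apply/hphi/h; rewrite size_map size_enum_ord.
have -> : s = rowseq (\row_(i < n) s`_i).
  apply: (@eq_from_nth _ 0) => [|i]; first by rewrite size_map size_enum_ord.
  by rewrite sn => lt_in; rewrite (nth_rowseq _ (Ordinal lt_in)) mxE.
by apply/hphi.
Qed.

(** * Lower bound for a positive polynomial on a closed semialgebraic set *)

Lemma continuous_polynomials (R : realType) (n : nat) :
  contains_polynomials (fun F : 'rV[R]_n -> R => continuous F).
Proof.
split.
- by move=> c; exact: cst_continuous.
- by move=> i x; exact: coord_continuous.
- by move=> F G cF cG x; apply: continuousD; [exact: cF | exact: cG].
- by move=> F G cF cG x; apply: continuousM; [exact: cF | exact: cG].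
Qed.

Lemma compact_enorm_ball (R : realType) (n : nat) (X : set 'rV[R]_n) (t : R) :
  closed X -> compact (X `&` [set x | enorm x ^+ 2 <= t]).
Proof.
move=> cX; apply: bounded_closed_compact.
  exists (1 + `|t|); split; first exact: num_real.
  move=> M ltM x [_ /= xt].
  rewrite [leLHS]/Num.norm /= mx_normrE; apply/bigmax_leP; split => /=.
    by have := normr_ge0 t; lra.
  move=> [i j] _ /=; rewrite ord1.
  apply: (le_trans (coord_le_enorm x j)).
  have := ler_norm t; have := normr_ge0 t; nra.
apply: closedI => //.
have cE := contains_enorm_sqr (@continuous_polynomials R n).
exact: (closed_comp (fun x _ => cE x) (@closed_le R t)).
Qed.

(** The truth value b of the condition [A t y] is constant in the region
    t >= K, y >= t^K.  It is true at t = K when y is large, by compactness, so it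
    is true at y = t^K for every t >= K; given x, take t = K + |x|^2. *)
Lemma lojasiewicz_at_infinity (R : realType) (n : nat) (X : set 'rV[R]_n)
    (f : mpoly.mpoly n R) :
  closed X -> semialgebraic X -> (forall x, X x -> 0 < peval f x) ->
  exists K : nat, forall x, X x ->
    1 <= (K%:R + enorm x ^+ 2) ^+ K * peval f x.
Proof.
move=> cX sX f0.
pose A t y (x : 'rV[R]_n) := X x -> enorm x ^+ 2 <= t -> 1 <= y * peval f x.
have defA : definable A.
  have [phi hphi] := definable_semialgebraic sX.
  have [u hu] := contains_peval (@term_fun_polynomials R n) f.
  have [v hv] := contains_enorm_sqr (@term_fun_polynomials R n).
  exists (ordered_qelim.ord.Implies phi (ordered_qelim.ord.Implies
    (ordered_qelim.ord.Le v (GRing.Var _ 0))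
    (ordered_qelim.ord.Le (GRing.Const 1) (GRing.Mul (GRing.Var _ 1) u)))).
  by move=> t y x /=; rewrite hu hv hphi.
have [psi hpsi] := definable_forall defA.
have [b [K hK]] := formula_at_far_const psi.
have {}hK t y : K%:R <= t -> t ^+ K <= y -> (forall x, A t y x) <-> b.
  by move=> tK yK; rewrite -hpsi; exact: hK.
suff hb : b.
  exists K => x Xx.
  have /hK/(_ (lexx _))/iffRL/(_ hb) : K%:R <= K%:R + enorm x ^+ 2 :> R.
    by rewrite lerDl sqr_ge0.
  by apply => //; rewrite lerDr ler0n.
pose B := X `&` [set x | enorm x ^+ 2 <= K%:R].
have [[x0 Bx0]|B0] := pselect (exists x, B x); last first.
  apply/(hK _ _ (lexx _) (lexx _)) => x Xx xK.
  by case: B0; exists x.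
have [|c /[!inE] -[Xc _] cmin] := compact_EVT_min (ex_intro _ x0 Bx0)
    (compact_enorm_ball (t := K%:R) cX) (f := peval f).
  exact/continuous_subspaceT/(contains_peval (@continuous_polynomials R n)).
have fc := f0 _ Xc.
apply/(hK K%:R (Num.max (K%:R ^+ K) (peval f c)^-1)); rewrite ?le_max ?lexx//.
move=> x Xx xK; have cx : peval f c <= peval f x by apply: cmin; rewrite inE.
rewrite -(mulVf (lt0r_neq0 fc)); apply: ler_pM => //; rewrite ?invr_ge0 ?(ltW fc)//.
by rewrite le_max lexx orbT.
Qed.

(** * Polynomial growth of a polynomial and its derivatives along lines *)

(** Using one integer both as the exponent and as the additive constant absorbs
    multiplicative constants, so that polynomial bounds need no other data. *)
Definition weight (R : realType) (n : nat) (K : nat) (x : 'rV[R]_n) : R :=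
  (K%:R + enorm x ^+ 2) ^+ K.

Lemma weight_ge1 (R : realType) (n K : nat) (x : 'rV[R]_n) : 1 <= weight K x.
Proof.
rewrite /weight; case: K => [|K]; first by rewrite expr0.
by rewrite exprn_ege1// ler_wpDr ?sqr_ge0// ler1n.
Qed.

(** Each factor is at most the same power of the larger base, and one of the
    remaining factors of that base is at least 4.  The second derivative of a
    product, p'' q + 2 p' q' + p q'', is what requires the constant 4. *)
Lemma weight_mul (R : realType) (n K L : nat) (x : 'rV[R]_n) :
  4 * (weight K x * weight L x) <= weight (K + L + 4) x.
Proof.
have e0 : 0 <= enorm x ^+ 2 := sqr_ge0 _.
rewrite /weight; set M := (K + L + 4)%N.
have M4 : 4 <= M%:R + enorm x ^+ 2.
  by rewrite ler_wpDr// (ler_nat R 4) leq_addl.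
have W0 : 0 <= M%:R + enorm x ^+ 2 by lra.
have le J : (J <= M)%N -> (J%:R + enorm x ^+ 2) ^+ J <= (M%:R + enorm x ^+ 2) ^+ J.
  by move=> JM; rewrite lerXn2r ?nnegrE ?addr_ge0 ?lerD2r ?ler_nat.
apply: (@le_trans _ _ ((M%:R + enorm x ^+ 2) ^+ (K + L).+1)); last first.
  by rewrite ler_weXn2l ?(le_trans _ M4) ?ler1n// /M addnS ltnS leq_addr.
rewrite [leRHS]exprS exprD; apply: ler_pM => //.
  by rewrite mulr_ge0// exprn_ge0// addr_ge0.
apply: ler_pM; rewrite ?exprn_ge0 ?addr_ge0//; apply: le.
  by rewrite /M -addnA leq_addr.
by rewrite /M -addnA addnCA leq_addr.
Qed.

(** The function d bounds, up to the factors |v| and |v|^2, the first two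
    derivatives of F in the direction v at every point of the line. *)
Definition line_bounded (R : realType) (n : nat) (F d : 'rV[R]_n -> R) : Prop :=
  forall z v, exists p : {poly R}, forall s,
    [/\ p.[s] = F (z + s *: v),
        `|p^`().[s]| <= d (z + s *: v) * enorm v &
        `|p^`()^`().[s]| <= d (z + s *: v) * enorm v ^+ 2].

Definition poly_growth (R : realType) (n : nat) (F : 'rV[R]_n -> R) : Prop :=
  exists K, (forall x, `|F x| <= weight K x) /\ line_bounded F (weight K).

Lemma poly_growth_polynomials (R : realType) (n : nat) :
  contains_polynomials (@poly_growth R n).
Proof.
have leM (x y z : R) : 0 <= z -> x <= y -> x * z <= y * z.
  by move=> *; exact: ler_wpM2r.
split.
- move=> c; pose K := (Num.bound `|c|).+1.
  have w0 (x : 'rV[R]_n) : 0 <= weight K x := le_trans ler01 (weight_ge1 K x).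
  exists K; split=> [x|z v].
    have e0 : 0 <= enorm x ^+ 2 := sqr_ge0 _.
    have cK : `|c| <= K%:R.
      by rewrite ltW// (lt_le_trans (archi_boundP _))// ler_nat.
    apply: (@le_trans _ _ (K%:R + enorm x ^+ 2)); first by lra.
    by rewrite /weight ler_eXnr// ler_wpDr// ler1n.
  exists c%:P => s; rewrite derivC deriv0 hornerC horner0 normr0.
  by split=> //; apply: mulr_ge0; rewrite ?w0 ?enorm_ge0 ?sqr_ge0.
- move=> i; exists 1%N; split=> [x|z v].
    rewrite /weight expr1 (le_trans (coord_le_enorm x i))//.
    have := sqr_ge0 (enorm x - 1 / 2); nra.
  exists ((z 0 i)%:P + v 0 i *: 'X) => s.
  rewrite derivD derivC add0r derivZ derivX derivZ -polyC1 derivC scaler0.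
  rewrite horner0 hornerD !hornerZ !hornerC hornerX mulr1 !mxE normr0.
  have w1 := weight_ge1 1 (z + s *: v).
  split; [by rewrite mulrC | | by rewrite mulr_ge0 ?sqr_ge0// (le_trans ler01)].
  by rewrite (le_trans (coord_le_enorm v i))// ler_peMl// enorm_ge0.
- move=> F G [K [FK lF]] [L [GL lG]]; exists (K + L + 4)%N.
  have wD (x : 'rV[R]_n) : weight K x + weight L x <= weight (K + L + 4) x.
    apply: (le_trans _ (weight_mul K L x)).
    have := weight_ge1 K x; have := weight_ge1 L x; nra.
  split=> [x|z v].
    by apply: (le_trans _ (wD x)); rewrite (le_trans (ler_normD _ _))// lerD.
  have [p hp] := lF z v; have [q hq] := lG z v; exists (p + q) => s.
  have [p0 p1 p2] := hp s; have [q0 q1 q2] := hq s.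
  rewrite !derivD !hornerD p0 q0; split=> //.
    apply: (le_trans _ (leM _ _ _ (enorm_ge0 v) (wD _))).
    by rewrite mulrDl (le_trans (ler_normD _ _))// lerD.
  apply: (le_trans _ (leM _ _ _ (sqr_ge0 (enorm v)) (wD _))).
  by rewrite mulrDl (le_trans (ler_normD _ _))// lerD.
- move=> F G [K [FK lF]] [L [GL lG]]; exists (K + L + 4)%N.
  have w0 J (x : 'rV[R]_n) : 0 <= weight J x := le_trans ler01 (weight_ge1 J x).
  have leMM (x y x' y' : R) : `|x| <= x' -> `|y| <= y' -> `|x * y| <= x' * y'.
    by move=> xx yy; rewrite normrM ler_pM.
  split=> [x|z v].
    apply: (le_trans _ (weight_mul K L x)).
    have := leMM _ _ _ _ (FK x) (GL x).
    have := mulr_ge0 (w0 K x) (w0 L x); lra.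
  have [p hp] := lF z v; have [q hq] := lG z v; exists (p * q) => s.
  have [p0 p1 p2] := hp s; have [q0 q1 q2] := hq s.
  have := FK (z + s *: v); have := GL (z + s *: v); rewrite -p0 -q0 => q0' p0'.
  have wM := weight_mul K L (z + s *: v).
  have wKL0 := mulr_ge0 (w0 K (z + s *: v)) (w0 L (z + s *: v)).
  have e0 := enorm_ge0 v.
  rewrite !(derivM, derivD) !hornerD !hornerM p0 q0; split=> //.
    apply: (le_trans _ (leM _ _ _ e0 wM)).
    rewrite -p0 -q0 (le_trans (ler_normD _ _))//.
    have := leMM _ _ _ _ p1 q0'; have := leMM _ _ _ _ p0' q1.
    have := mulr_ge0 wKL0 e0; lra.
  apply: (le_trans _ (leM _ _ _ (sqr_ge0 (enorm v)) wM)).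
  rewrite -p0 -q0.
  apply: (le_trans (ler_normD _ _)).
  apply: (le_trans (lerD (ler_normD _ _) (ler_normD _ _))).
  have := leMM _ _ _ _ p2 q0'; have := leMM _ _ _ _ p1 q1.
  have := leMM _ _ _ _ p0' q2; lra.
Qed.

(** * Strong convexity from a pointwise inequality *)

Lemma enorm_sqr_line (R : realType) (n : nat) (z v : 'rV[R]_n) :
  exists q : {poly R}, forall s,
    q.[s] = enorm (z + s *: v) ^+ 2 /\ q^`()^`().[s] = 2 * enorm v ^+ 2.
Proof.
exists ((\sum_(i < n) z 0 i ^+ 2)%:P + (\sum_(i < n) 2 * z 0 i * v 0 i) *: 'X +
  (\sum_(i < n) v 0 i ^+ 2) *: 'X^2) => s; split.
  rewrite !hornerD !hornerZ hornerC hornerX hornerXn enorm_sqr.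
  rewrite !mulr_suml -!big_split /=; apply: eq_bigr => i _.
  by rewrite !mxE; ring.
by rewrite enorm_sqr !(poly.derivE, hornerE) /=; ring.
Qed.

(** The derivative is again exp (exp q) times a function, up to a polynomial
    term: applying the lemma twice gives the second derivative. *)
Lemma is_derive_expexp (R : realType) (q k : {poly R}) (U : R -> R) (s dU : R) :
  is_derive s 1 U dU ->
  is_derive s 1 (fun s => expR (expR q.[s]) * U s - k.[s])
    (expR (expR q.[s]) * (expR q.[s] * q^`().[s] * U s + dU) - k^`().[s]).
Proof.
move=> dUs.
have dq := is_derive1_comp (is_derive_expR q.[s]) (is_derive_poly q s).
have dE := is_derive1_comp (is_derive_expR ((expR \o horner q) s)) dq.
apply: is_derive_eq (is_deriveB (is_deriveM dE dUs) (is_derive_poly k s)) _.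
by rewrite /GRing.scale /= /GRing.scale /=; ring.
Qed.

(** The hypothesis says that the second derivative of [h] is nonnegative on
    ]0, 1[; its right-hand side is expanded so that the square in
    the derivative of exp q can be completed. *)
Lemma expexp_convex (R : realType) (q p k : {poly R}) (t : {i01 R}) :
  let h (s : R) := expR (expR q.[s]) * p.[s] - k.[s] in
  (forall s : R, 0 < s < 1 -> k^`()^`().[s] <= expR (expR q.[s]) *
     (expR q.[s] * (q^`()^`().[s] * p.[s]) + expR q.[s] * q^`().[s] ^+ 2 * p.[s]
      + (expR q.[s] * q^`().[s]) ^+ 2 * p.[s]
      + 2 * (expR q.[s] * q^`().[s]) * p^`().[s] + p^`()^`().[s])) ->
  h (1 - t%:num) <= t%:num * h 0 + (1 - t%:num) * h 1.
Proof.
move=> h k_le.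
pose V (s : R) := expR q.[s] * q^`().[s] * p.[s] + p^`().[s].
have dh (s : R) : is_derive s 1 h (expR (expR q.[s]) * V s - k^`().[s]).
  exact: is_derive_expexp (is_derive_poly p s).
have dhE : 'D_1 h = fun s => expR (expR q.[s]) * V s - k^`().[s].
  by apply/funext => s; rewrite (@derive_val _ _ _ _ _ _ _ (dh s)).
have dV (s : R) : is_derive s 1 V (expR q.[s] * q^`()^`().[s] * p.[s]
    + expR q.[s] * q^`().[s] ^+ 2 * p.[s] + expR q.[s] * q^`().[s] * p^`().[s]
    + p^`()^`().[s]).
  have dq := is_derive1_comp (is_derive_expR q.[s]) (is_derive_poly q s).
  have dqq := is_deriveM dq (is_derive_poly q^`() s).
  apply: is_derive_eq (is_deriveD (is_deriveM dqq (is_derive_poly p s))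
    (is_derive_poly p^`() s)) _.
  by rewrite /GRing.scale /= /GRing.scale !fctE /=; ring.
have ddh (s : R) := is_derive_expexp q k^`() (dV s).
have ch : continuous h.
  by move=> s; apply/differentiable_continuous/derivable1_diffP; case: (dh s).
have -> : t%:num * h 0 + (1 - t%:num) * h 1 = conv t (h 0 : R^o) (h 1).
  by rewrite convRE.
have -> : 1 - t%:num = conv t (0 : R^o) 1 by rewrite convRE mulr0 mulr1 add0r.
apply: second_derivative_convex; last exact: ler01.
- move=> s /k_le; rewrite dhE (@derive_val _ _ _ _ _ _ _ (ddh s)) -subr_ge0.
  by congr (0 <= _); rewrite /V; ring.
- exact/cvg_at_left_filter/ch.
- exact/cvg_at_right_filter/ch.
- by move=> s _; case: (dh s).
- by move=> s _; rewrite dhE; case: (ddh s).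
Qed.

(** Along a segment, with g = exp q, the terms (g q')^2 F + 2 (g q') F' are at
    least - F'^2 / F >= - d^2 |v|^2 / F, while g q'' F = 2 a |v|^2 g F.  The
    hypothesis leaves |v|^2, which is the second derivative of |x|^2 / 2. *)
Lemma strongly_convex_expexp (R : realType) (n : nat) (X : set 'rV[R]_n)
    (a : R) (xi : 'rV[R]_n) (F d : 'rV[R]_n -> R) :
  convex_set X -> 0 <= a -> line_bounded F d -> (forall x, X x -> 0 < F x) ->
  (forall x, X x -> d x ^+ 2 / F x + d x + 1 <=
     2 * a * expR (a * enorm (x - xi) ^+ 2) * F x) ->
  strongly_convex X (fun x => expR (expR (a * enorm (x - xi) ^+ 2)) * F x).
Proof.
move=> cX a0 lF F0 dF; exists 1; split=> // t x y Xx Xy.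
pose v := y - x.
have [q0 q0E] := enorm_sqr_line (x - xi) v.
have [k0 k0E] := enorm_sqr_line x v.
have [p pE] := lF x v.
pose q := a *: q0; pose k := (1 / 2) *: k0.
pose h s := expR (expR q.[s]) * p.[s] - k.[s].
have hE s : h s = expR (expR (a * enorm (x + s *: v - xi) ^+ 2)) *
    F (x + s *: v) - 1 / 2 * enorm (x + s *: v) ^+ 2.
  rewrite /h !hornerZ; have [-> _] := q0E s; have [-> _] := k0E s.
  by have [-> _ _] := pE s; rewrite addrAC.
suff : h (1 - t%:num) <= t%:num * h 0 + (1 - t%:num) * h 1.
  rewrite !hE scale0r addr0 scale1r /v [x + (y - x)]addrC subrK.
  have -> // : x + (1 - t%:num) *: (y - x) = conv t (x : convex_lmodType _) y.
  have -> : conv t (x : convex_lmodType _) y =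
    t%:num *: x + (1 - t%:num) *: y :> 'rV_n by [].
  by apply/rowP => i; rewrite !mxE; ring.
apply: expexp_convex => s /andP[s0 s1].
have Xw : X (x + s *: v).
  have s0' : 0 <= 1 - s by lra.
  have s1' : 1 - s <= 1 by lra.
  have := cX x y (Itv01 s0' s1') Xx Xy.
  have -> : conv (Itv01 s0' s1') (x : convex_lmodType _) y =
    (1 - s) *: x + (1 - (1 - s)) *: y :> 'rV_n by [].
  rewrite inE; congr X.
  by apply/rowP => i; rewrite /v !mxE; ring.
have {dF} := dF _ Xw; have {F0} := F0 _ Xw.
have [<- p1 p2] := pE s.
have qE : q.[s] = a * enorm (x + s *: v - xi) ^+ 2.
  by rewrite hornerZ; have [-> _] := q0E s; rewrite addrAC.
have -> : q^`()^`().[s] = 2 * a * enorm v ^+ 2.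
  by rewrite !derivZ hornerZ; have [_ ->] := q0E s; ring.
have -> : k^`()^`().[s] = enorm v ^+ 2.
  by rewrite !derivZ hornerZ; have [_ ->] := k0E s; field.
rewrite -qE.
move: (p.[s]) (p^`().[s]) (p^`()^`().[s]) (q^`().[s]) p1 p2 => P P1 P2 Q1.
have := expR_ge1Dx (expR q.[s]); have := expR_ge0 q.[s].
move: (expR q.[s]) => g; move: (expR g) => E.
move: (d _) (enorm v) (enorm_ge0 v) => D V V0 g0 gE P1D P2D P0 DP.
set B := (X in _ <= _ * X).
suff : V ^+ 2 <= B.
  have E1 : 1 <= E by lra.
  by move=> VB; apply: (le_trans VB); rewrite ler_peMl// (le_trans _ VB)// sqr_ge0.
(* Completing the square in the derivative g * Q1 of g = exp q. *)
have sq : 0 <= P * (g * Q1 + P1 / P) ^+ 2.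
  by rewrite mulr_ge0 ?sqr_ge0// ltW.
have P1V : P1 ^+ 2 / P <= D ^+ 2 * V ^+ 2 / P.
  rewrite ler_wpM2r ?invr_ge0 ?(ltW P0)// -exprMn -real_normK ?num_real//.
  by rewrite lerXn2r// nnegrE ?(le_trans _ P1D).
have P2V : - (D * V ^+ 2) <= P2 by move: P2D; rewrite ler_norml => /andP[].
have {}DP : (D ^+ 2 / P + D + 1) * V ^+ 2 <= 2 * a * g * P * V ^+ 2.
  by rewrite ler_wpM2r ?sqr_ge0.
have BE : B = 2 * a * g * P * V ^+ 2 + P * (g * Q1 + P1 / P) ^+ 2
    - P1 ^+ 2 / P + P2 + g * Q1 ^+ 2 * P.
  by rewrite /B; field; exact: lt0r_neq0.
have : 0 <= g * Q1 ^+ 2 * P.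
  exact: mulr_ge0 (mulr_ge0 g0 (sqr_ge0 _)) (ltW P0).
clearbody B; lra.
Qed.

(** * Exponential growth beats polynomial growth *)

(** Apply 1 + u <= exp u to u = q / L and raise to the power L. *)
Lemma exprD1_le_expR (R : realType) (L : nat) (q : R) : 0 <= q ->
  (1 + q) ^+ L <= L%:R ^+ L * expR q.
Proof.
case: L => [|L] q0; first by rewrite !expr0 mul1r; have := expR_ge1Dx q; lra.
have L0 : 0 < L.+1%:R :> R by rewrite ltr0n.
have -> : expR q = expR (q / L.+1%:R) ^+ L.+1.
  by rewrite -expRM_natl mulrC divfK// lt0r_neq0.
rewrite -exprMn lerXn2r ?nnegrE ?addr_ge0 ?mulr_ge0 ?expR_ge0//.
apply: (@le_trans _ _ (L.+1%:R * (1 + q / L.+1%:R))); last first.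
  by rewrite ler_pM2l// expR_ge1Dx.
by rewrite mulrDr mulr1 [_ * (q / _)]mulrC divfK ?lt0r_neq0// lerD2r ler1n.
Qed.

Lemma enorm_sqr_shift (R : realType) (n : nat) (x xi : 'rV[R]_n) :
  enorm x ^+ 2 <= 2 * enorm (x - xi) ^+ 2 + 2 * enorm xi ^+ 2.
Proof.
rewrite !enorm_sqr !mulr_sumr -big_split /=; apply: ler_sum => i _.
by rewrite !mxE; have := sqr_ge0 (x 0 i - 2 * xi 0 i); lra.
Qed.

(** The constant depends on xi only through r: since |x|^2 is at most
    2 |x - xi|^2 + 2 r^2, the base of the weight is at most B (1 + |x - xi|^2). *)
Lemma weight_le_expR (R : realType) (n J : nat) (r : R) : exists M : R, 0 <= M /\
  forall x xi : 'rV[R]_n, enorm xi <= r ->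
    weight J x ^+ 2 <= M * expR (enorm (x - xi) ^+ 2).
Proof.
pose B := J%:R + 2 + 2 * r ^+ 2.
have B0 : 0 <= B.
  by rewrite /B addr_ge0 ?addr_ge0 ?ler0n// mulr_ge0// sqr_ge0.
exists (B ^+ (J * 2) * (J * 2)%:R ^+ (J * 2)).
split=> [|x xi xi_r]; first by rewrite mulr_ge0 ?exprn_ge0.
have q0 : 0 <= enorm (x - xi) ^+ 2 := sqr_ge0 _.
rewrite /weight -exprM -mulrA.
have := ler_wpM2l (exprn_ge0 (J * 2) B0) (exprD1_le_expR (J * 2) q0).
apply: le_trans; rewrite -exprMn.
have J0 : 0 <= J%:R :> R by rewrite ler0n.
have xi2 : enorm xi ^+ 2 <= r ^+ 2.
  by rewrite lerXn2r ?nnegrE ?enorm_ge0// (le_trans _ xi_r) ?enorm_ge0.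
have shift := enorm_sqr_shift x xi; have r0 := sqr_ge0 r.
have x0 : 0 <= enorm x ^+ 2 := sqr_ge0 _.
have : J%:R + enorm x ^+ 2 <= B * (1 + enorm (x - xi) ^+ 2).
  rewrite /B; have := mulr_ge0 J0 q0; have := mulr_ge0 r0 q0; lra.
by apply: lerXn2r; rewrite nnegrE; [exact: addr_ge0 | apply/mulr_ge0/addr_ge0].
Qed.

Theorem theorem6 (R : realType) (n : nat) (X : set 'rV[R]_n) (r : R)
    (f : mpoly.mpoly n R) :
  convex_set X -> closed X -> semialgebraic X -> 0 < r ->
  (forall x : 'rV[R]_n, X x -> 0 < peval f x) ->
  (exists N0 : nat, forall N : nat, (N0 <= N)%N ->
     forall xi : 'rV[R]_n, enorm xi <= r ->
       strongly_convex X (fun x : 'rV[R]_n =>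
         expR (expR (N%:R * enorm (x - xi) ^+ 2)) * peval f x))
  /\
  (exists alpha : R, forall xi : 'rV[R]_n, enorm xi <= r ->
     strongly_convex X (fun x : 'rV[R]_n =>
       expR (expR (enorm (x - xi) ^+ 2)) * (peval f x + alpha))).
Proof.
move=> cX clX sX r0 f0.
have [K [fK lf]] := contains_peval (@poly_growth_polynomials R n) f.
have w1 J (x : 'rV[R]_n) := weight_ge1 J x.
split.
- have [L hL] := lojasiewicz_at_infinity clX sX f0.
  have [M [M0 hM]] := weight_le_expR n (K + L + 4) r.
  exists (Num.bound M).+1 => N NM xi xi_r.
  have N1 : 1 <= N%:R :> R by rewrite ler1n (leq_trans _ NM).
  have {}NM : M <= N%:R.
    by rewrite ltW// (lt_le_trans (archi_boundP M0))// ler_nat (leq_trans _ NM).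
  apply: (strongly_convex_expexp cX _ lf f0) => // x Xx; rewrite -(mulrA 2).
  have {fK} d1 := w1 K x; have wL := w1 L x; have fx := f0 x Xx.
  have wf : 1 <= weight L x * peval f x := hL x Xx.
  (* One power of the weight L pays for 1 / f, the other one for the factor f on
     the right-hand side. *)
  have big : (4 * (weight K x * weight L x)) ^+ 2 <=
      N%:R * expR (N%:R * enorm (x - xi) ^+ 2).
    apply: (@le_trans _ _ (weight (K + L + 4) x ^+ 2)).
      have := weight_mul K L x; have := w1 (K + L + 4)%N x => wJ wm.
      have p0 : 0 <= weight K x * weight L x by apply: mulr_ge0; lra.
      by apply: lerXn2r wm; rewrite nnegrE; lra.
    apply: (le_trans (hM x xi xi_r)); rewrite ler_pM ?expR_ge0//.
    by rewrite ler_expR ler_peMl// sqr_ge0.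
  move: (weight K x) (weight L x) (peval f x) (N%:R * expR _) d1 wL fx wf big.
  move=> d w y e d1 w1' y0 wy big.
  have T1 : d <= d ^+ 2 * w by nra.
  have dy : d ^+ 2 / y <= d ^+ 2 * w.
    by rewrite ler_wpM2l ?sqr_ge0// -[y^-1]mul1r ler_pdivrMr.
  have ey : 16 * (d ^+ 2 * w) <= e * y.
    apply: (@le_trans _ _ (16 * (d ^+ 2 * w) * (w * y))).
      by rewrite ler_peMr// !mulr_ge0 ?sqr_ge0// (le_trans ler01).
    rewrite mulrA ler_wpM2r// ?(ltW y0)//; apply: le_trans big.
    by rewrite le_eqVlt; apply/orP; left; apply/eqP; ring.
  lra.
have [M [M0 hM]] := weight_le_expR n K r.
(* Here d^2 <= M e, with e the exponential of |x - xi|^2, so that 2 M e bounds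
   d^2 / (f + alpha) + d as soon as f + alpha >= 1. *)
exists (2 * M + 1) => xi xi_r.
have f1 x : X x -> 2 * M + 1 < peval f x + (2 * M + 1).
  by move=> /f0; lra.
have -> : (fun x => expR (expR (enorm (x - xi) ^+ 2)) *
      (peval f x + (2 * M + 1))) =
    fun x => expR (expR (1 * enorm (x - xi) ^+ 2)) * (peval f x + (2 * M + 1)).
  by apply/funext => x; rewrite mul1r.
apply: (strongly_convex_expexp cX ler01 (d := weight K)) => [z v|x /f1|x Xx].
- have [p hp] := lf z v; exists (p + (2 * M + 1)%:P) => s.
  have [p0 p1 p2] := hp s.
  by rewrite derivD derivC addr0 hornerD hornerC p0.
- lra.
rewrite mulr1 mul1r; have := f1 x Xx; have := hM x xi xi_r.
have := expR_ge1Dx (enorm (x - xi) ^+ 2); have := sqr_ge0 (enorm (x - xi)).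
have := w1 K x.
move: (weight K x) (expR _) (peval f x + _) => d e y d1 q0 qe de My.
have y1 : 1 <= y by lra.
have dy : d ^+ 2 / y <= d ^+ 2.
  by rewrite ler_pdivrMr ?ler_peMr ?sqr_ge0// (lt_le_trans ltr01).
have dd : d <= d ^+ 2 by rewrite expr2 ler_peMr// (le_trans ler01).
have e1 : 1 <= e by lra.
have ey : (2 * M + 1) * e <= e * y by rewrite mulrC ler_wpM2l ?(le_trans ler01)// ltW.
lra.
Qed.
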